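(* Let $G$ be a decomposable cubic graph that has a bridge. Then $\mathrm{mms}(G)\ge \nu(G)-1$, where $\nu(G)$ is the size of a maximum matching of $G$.
   Context: All graphs are finite and simple; a cubic graph is one in which every vertex has degree $3$. A matching $M$ of $G$ is separating if $G-M$ has more connected components than $G$. A graph is decomposable if it has a separating matching (equivalently, a matching cut: a matching that equals the set of edges between $X$ and $V(G)\setminus X$ for some nonempty proper $X\subseteq V(G)$). $\mathrm{mms}(G)$ denotes the maximum size of a separating matching of $G$ (and $\mathrm{mms}(G)=0$ if none exists). A bridge is an edge whose removal increases the number of connected components. *)

(* Defs.v *)
From mathcomp Require Import all_boot.

Set Implicit Arguments.
Unset Strict Implicit.
Unset Printing Implicit Defensive.

Record sgraph := SGraph {
  vertex :> finType;
  adj : rel vertex;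
  adj_sym : symmetric adj;
  adj_irrefl : irreflexive adj
}.

Section SimpleGraph.

Variable G : sgraph.

Definition cubic : Prop := forall x : G, #|[set y : G | adj x y]| = 3.

Definition edges : {set {set G}} :=
  [set E : {set G} | [exists x, exists y, adj x y && (E == [set x; y])]].

Definition matching (M : {set {set G}}) : bool :=
  (M \subset edges) && trivIset M.

(* G - M keeps all vertices. Being symmetric, this relation and adj have an
   n_comp that counts connected components. *)
Definition del_edges (M : {set {set G}}) : rel G :=
  [rel x y | adj x y && ([set x; y] \notin M)].

Definition separates (M : {set {set G}}) : bool :=
  n_comp (@adj G) predT < n_comp (del_edges M) predT.

Definition separating_matching (M : {set {set G}}) : bool :=
  matching M && separates M.

Definition decomposable : Prop :=
  exists M : {set {set G}}, separating_matching M.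

Definition bridge (E : {set G}) : bool :=
  (E \in edges) && separates [set E].

(* The empty maximum is 0, which is the convention for mms when G has no
   separating matching. *)
Definition mms : nat :=
  \max_(M : {set {set G}} | separating_matching M) #|M|.

Definition nu : nat :=
  \max_(M : {set {set G}} | matching M) #|M|.

End SimpleGraph.

(* Main.v *)
(* A matching containing a bridge is separating.  Given a maximum matching and
   a bridge {u, v}, remove the at most two edges of the matching that meet
   {u, v} and add the bridge. *)
Require Import Defs.
From mathcomp Require Import all_boot.

Set Implicit Arguments.
Unset Strict Implicit.
Unset Printing Implicit Defensive.

(** Swapping a bridge into a maximum matching costs at most one edge: at most two disjoint edges
    touch its endpoints, and the bridge itself is gained ([matching_exchange],
    [matching_exchange_card]). The new matching contains the bridge, and deleting further edges
    never lowers the number of components ([n_comp_subrel]), so it still separates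
    ([separates_subset]). *)

Lemma n_comp_subrel (T : finType) (e e' : rel T) :
    connect_sym e -> connect_sym e' -> subrel e e' ->
  n_comp e' predT <= n_comp e predT.
Proof.
move=> sym_e sym_e' sub_e.
(* Two [e']-roots with the same [e]-root are [e]-connected, hence [e']-connected, hence equal. *)
have root_inj : {in [predI roots e' & predT] &, injective (root e)}.
  move=> x y /andP[/eqP rx _] /andP[/eqP ry _] /(rootP sym_e) xy.
  rewrite -rx -ry; apply/(rootP sym_e').
  by apply: connect_sub xy => a b /sub_e; apply: connect1.
rewrite /n_comp_mem -(card_in_image root_inj) subset_leq_card //.
by apply/subsetP=> _ /imageP[x _ ->]; rewrite !inE roots_root.
Qed.

Lemma del_edges_connect_sym (G : sgraph) (M : {set {set G}}) :
  connect_sym (del_edges M).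
Proof.
by apply: sym_connect_sym => x y; rewrite /del_edges /= adj_sym setUC.
Qed.

Lemma separates_subset (G : sgraph) (M N : {set {set G}}) :
  M \subset N -> separates M -> separates N.
Proof.
move=> /subsetP sMN sepM; apply: leq_trans sepM _.
apply: n_comp_subrel; try exact: del_edges_connect_sym.
move=> x y /andP[xy xyN]; apply/andP; split=> //.
by apply: contra xyN => /sMN.
Qed.

Lemma matching_exchange (G : sgraph) (M : {set {set G}}) (E : {set G}) :
    matching M -> E \in edges G ->
  matching (E |: [set F in M | [disjoint F & E]]).
Proof.
move=> /andP[/subsetP sM tM] edgeE; apply/andP; split.
  by apply/subsetP=> F /setU1P[->|]// /setIdP[/sM].
apply/trivIsetP=> A B; rewrite !inE.
move=> /orP[/eqP ->|/andP[AM AE]] /orP[/eqP ->|/andP[BM BE]]; rewrite ?eqxx //.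
- by rewrite disjoint_sym.
- by move: A B AM BM {AE BE}; apply/trivIsetP.
Qed.

Lemma matching_exchange_card (G : sgraph) (M : {set {set G}}) (E : {set G}) :
    matching M -> E \in edges G ->
  #|M| - 1 <= #|E |: [set F in M | [disjoint F & E]]|.
Proof.
move=> /andP[_ tM]; rewrite inE => /existsP[u /existsP[v /andP[_ /eqP ->]]].
set E' := [set u; v]; set N := [set F in M | [disjoint F & E']].
(* A nonempty edge meets itself, so it is never among the kept edges, even if it lies in [M]; adding
   it always gains one. *)
have E'N : E' \notin N.
  rewrite inE negb_and -setI_eq0 setIid; apply/orP; right.
  by apply/set0Pn; exists u; rewrite set21.
(* A discarded edge contains [u] or [v], so it is the block of [M] through that vertex. At an
   uncovered vertex [pblock] is [set0], harmless in an upper bound. *)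
have sMN : M :\: N \subset [set pblock M u; pblock M v].
  apply/subsetP=> F; rewrite !inE andbC => /andP[FM]; rewrite FM /= -setI_eq0.
  case/set0Pn=> x; rewrite !inE => /andP[xF /orP[]/eqP eqx];
    by rewrite -eqx (def_pblock tM FM xF) eqxx ?orbT.
have card_MN : #|M :\: N| <= 2.
  by rewrite (leq_trans (subset_leq_card sMN)) // cards2; case: eqP.
have sNM : N \subset M by apply/subsetP=> F; rewrite inE => /andP[].
rewrite cardsU1 E'N -(cardsID N M) (setIidPr sNM) leq_subLR addnA addnC.
by rewrite leq_add2r.
Qed.

Theorem theorem3 (G : sgraph) (G_cubic : cubic G) (G_dec : decomposable G)
    (G_bridge : exists E : {set G}, bridge E) :
  nu G - 1 <= mms G.
Proof.
have [E /andP[edgeE sepE]] := G_bridge.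
(* This makes the range of the maximum nonempty, so that some [M] attains [nu G]. *)
have matching0 : matching (set0 : {set {set G}}).
  by rewrite /matching sub0set; apply/trivIsetP=> A B; rewrite inE.
have [M matchM nuM] :
    {M : {set {set G}} | matching M & nu G = #|M|}.
  by apply: eq_bigmax_cond; apply/card_gt0P; exists set0.
rewrite nuM; apply: leq_trans (matching_exchange_card matchM edgeE) _.
apply: (@leq_bigmax_cond _ (@separating_matching G) (fun N => #|N|)).
rewrite /separating_matching matching_exchange //=.
by apply: separates_subset sepE; rewrite sub1set setU11.
Qed.
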